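(* Let $X=Y=\mathbb{R}\times\mathbb{R}^{2}=\mathbb{R}^3$, with elements $x=(x_n,x_t)\in X$, $y=(y_n,y_t)\in Y$, duality product $\langle x,y\rangle=x_ny_n+x_t\cdot y_t$ (the usual scalar product), and $\|\cdot\|$ the Euclidean norm. Let $0<\mu_{-}\leq\mu_{+}$ and let the blurred Coulomb friction law be represented by the graph $$M=\{(x,0)\in X\times Y\mid x_n<0\}\ \cup\ \{(x,y)\in X\times Y\mid x_n=0,\ \mu_{-}y_n\leq\|y_t\|\leq\mu_{+}y_n,\ \exists\,\eta\geq0,\ x_t=\eta y_t\}.$$ Then the blurred friction law with the graph $M$ is represented by the bipotential $$b(x,y)=\sup(\mu_{-}y_n,\|y_t\|)\,\|x_t\|+\chi_{K_{\mu_{+}}}(y)+\chi_{K_{0}^{*}}(x),$$ that is, $b$ is a bipotential and $M=M(b)$. Equivalently, the relation ''$y\in\partial b_{\mu}(\cdot,y)(x)$ for some $\mu\in[\mu_{-},\mu_{+}]$'', where $$b_{\mu}(x,y)=\mu y_n\|x_t\|+\chi_{K_{\mu}}(y)+\chi_{K_{0}^{*}}(x),$$ can be put in the form $y\in\partial b(\cdot,y)(x)$, with $b$ the bipotential above.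
   Context: Write $\bar{\mathbb{R}}=\mathbb{R}\cup\{+\infty\}$. Here $x_n$ is the gap velocity, $x_t$ the sliding velocity, $y_n$ the contact pressure and $y_t$ minus the friction stress; $\mu>0$ is a friction coefficient. Coulomb's cone is $K_\mu=\{(y_n,y_t)\in Y\mid\|y_t\|\leq\mu y_n\}$, and $K_0^*=\{(x_n,x_t)\in X\mid x_n\leq0\}$. For a closed convex set $A$, $\chi_{A}$ is its indicator function: $\chi_A=0$ on $A$ and $+\infty$ off $A$; a sum containing an indicator term equals $+\infty$ wherever that indicator is $+\infty$. The subdifferential of $\phi:X\to\bar{\mathbb{R}}$ at $x\in X$ is the (possibly empty) set $\partial\phi(x)=\{u\in Y \mid \forall z\in X,\ \langle z-x,u\rangle\leq\phi(z)-\phi(x)\}$ (with the usual convention that it is empty when $\phi(x)=+\infty$), and similarly for functions on $Y$ (with subgradients in $X$). The notation $\partial b(\cdot,y)(x)$ means the subdifferential at $x$ of the function $z\mapsto b(z,y)$ on $X$, and $\partial b(x,\cdot)(y)$ means the subdifferential at $y$ of the function $w\mapsto b(x,w)$ on $Y$. A bipotential is a function $b:X\times Y\to\bar{\mathbb{R}}$ such that: (a) $b$ is convex and lower semicontinuous in each argument; (b) $b(x,y)\geq\langle x,y\rangle$ for all $x\in X$, $y\in Y$; (c) for all $(x,y)\in X\times Y$: $y\in\partial b(\cdot,y)(x)\iff x\in\partial b(x,\cdot)(y)\iff b(x,y)=\langle x,y\rangle$. The graph of a bipotential $b$ is $M(b)=\{(x,y)\in X\times Y\mid b(x,y)=\langle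 x,y\rangle\}$. A law with graph $M$ is represented by (admits) the bipotential $b$ if $M=M(b)$.
   Formalization: M = M(b) is false as written (x=0, y=(1,0) is in M(b), not in M); what is proved is that M(b) is M together with the states x_n=0, x_t≠0, y=0 and the states x=0, ‖y_t‖<μ₋y_n; the other claims are unchanged. *)

(* Defs.v *)
From HB Require Import structures.
From mathcomp Require Import all_boot all_order all_algebra.
From mathcomp Require Import all_classical all_reals all_analysis.

Set Implicit Arguments.
Unset Strict Implicit.
Unset Printing Implicit Defensive.

Import Order.TTheory GRing.Theory Num.Theory.
Import numFieldNormedType.Exports.

Local Open Scope classical_set_scope.
Local Open Scope ring_scope.

(* X = Y = R x R^2. The normal component is typed in R^o so that the product is
   a module over R. The library topology on this product (sup norm) is the
   usual one of R^3; the Euclidean norm is [enorm] below. *)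
Notation contact_space R := (R^o * 'rV[R]_2)%type.

Section Bipotentials.
Context {R : realType}.
Implicit Types (u v : 'rV[R]_2) (x y z : contact_space R).

Definition dot u v : R := \sum_(i < 2) u 0 i * v 0 i.

Definition enorm u : R := Num.sqrt (dot u u).

Definition duality x y : R := x.1 * y.1 + dot x.2 y.2.

Definition chi (A : set (contact_space R)) (x : contact_space R) : \bar R :=
  if x \in A then 0%E else +oo%E.

(* With values in R \cup {+oo} and the library convention 0 * +oo = 0, this is
   the usual notion, including at the end points t = 0 and t = 1. *)
Definition econvex (phi : contact_space R -> \bar R) : Prop :=
  forall x z (t : R), 0 <= t <= 1 ->
    (phi (t *: x + (1 - t) *: z)%R <= t%:E * phi x + (1 - t)%R%:E * phi z)%E.

(* Since X = Y and [duality] is symmetric, the same definition serves for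
   functions on X and for functions on Y. *)
Definition subdifferential (phi : contact_space R -> \bar R) (x : contact_space R)
    : set (contact_space R) :=
  [set u | (phi x < +oo)%E /\
    forall z, ((duality (z - x)%R u)%:E <= phi z - phi x)%E].

Definition bipotential (b : contact_space R -> contact_space R -> \bar R) : Prop :=
  [/\ (* values in R \cup {+oo} *)
      forall x y, (-oo < b x y)%E,
      (forall y, econvex (b^~ y) /\ lower_semicontinuous (b^~ y)) /\
      (forall x, econvex (b x) /\ lower_semicontinuous (b x)),
      forall x y, ((duality x y)%:E <= b x y)%E
    & forall x y,
        (subdifferential (b^~ y) x y <-> subdifferential (b x) y x) /\
        (subdifferential (b x) y x <-> b x y = (duality x y)%:E)].

Definition graph (b : contact_space R -> contact_space R -> \bar R)
    : set (contact_space R * contact_space R) :=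
  [set p | b p.1 p.2 = (duality p.1 p.2)%:E].

Definition coulomb_cone (mu : R) : set (contact_space R) :=
  [set y | enorm y.2 <= mu * y.1].

Definition K0_dual : set (contact_space R) := [set x | x.1 <= 0].

Definition coulomb_bipotential (mu : R) x y : \bar R :=
  ((mu * y.1 * enorm x.2)%:E + chi (coulomb_cone mu) y + chi K0_dual x)%E.

Definition blurred_bipotential (mum mup : R) x y : \bar R :=
  ((Num.max (mum * y.1) (enorm y.2) * enorm x.2)%:E
   + chi (coulomb_cone mup) y + chi K0_dual x)%E.

Definition blurred_graph (mum mup : R) : set (contact_space R * contact_space R) :=
  [set p | p.1.1 < 0 /\ p.2 = 0] `|`
  [set p | [/\ p.1.1 = 0,
               mum * p.2.1 <= enorm p.2.2 <= mup * p.2.1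
             & exists eta : R, 0 <= eta /\ p.1.2 = eta *: p.2.2]].

(* The states on which [blurred_graph], as usually written, disagrees with the
   union of the graphs of the Coulomb laws with coefficient in [mum, mup] (and
   with the graph of [blurred_bipotential]): grazing sliding with no contact
   force (x_n = 0, x_t <> 0, y = 0), and sticking strictly inside the inner
   cone (x = 0, |y_t| < mum * y_n). For instance b(x, y) = 0 = <x, y> at x = 0,
   y = (1, 0), although mum * y_n <= |y_t| fails there. *)
Definition boundary_states (mum : R) : set (contact_space R * contact_space R) :=
  [set p | [/\ p.1.1 = 0, p.1.2 != 0 & p.2 = 0]] `|`
  [set p | p.1 = 0 /\ enorm p.2.2 < mum * p.2.1].

End Bipotentials.

(* Main.v *)
Require Import Defs.
From mathcomp Require Import all_boot all_order all_algebra.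
From mathcomp Require Import all_classical all_reals all_analysis.
From mathcomp Require Import ring lra.

Import Order.TTheory GRing.Theory Num.Theory.
Import numFieldNormedType.Exports.

Local Open Scope classical_set_scope.
Local Open Scope ring_scope.

(** Let b be any function of the form c(y) |x_t|, with value +oo when y is
outside a set K or x_n > 0, where every y in K satisfies y_n >= 0 and
|y_t| <= c(y). By Cauchy-Schwarz, <x,y> <= |x_t| |y_t| <= c(y) |x_t|, so b
dominates the duality product. A function phi that dominates <.,u>, and that
vanishes at 0 if it is finite at x, has u as a subgradient at x exactly when
phi(x) = <x,u> ([subdifferential_contact]): one direction is the domination,
the other is the subgradient inequality tested at 0. This applies to b(.,y),
and to b(x,.) when c(0) = 0 and K contains 0. It settles the equivalences in
the definition of a bipotential and reduces everything else to the contact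
equation b(x,y) = <x,y>. Convexity and semicontinuity hold when K is closed and
convex and c is continuous and convex on K, because each partial function of b
is then the sum of a continuous function, convex on a closed convex set, and of
the indicator of that set ([friction_bipotential]).

Both Coulomb's bipotential b_mu, with c(y) = mu y_n, and the blurred one, with
c(y) = max(mum y_n, |y_t|), are of this form. On contact, a state of the
blurred law with y_n > 0 satisfies the Coulomb law of coefficient c(y) / y_n,
which belongs to [mum, mup] because y is in the outer cone; if y_n = 0 then
y = 0 and any coefficient is suitable ([blurred_coefficient]). Finally the
contact equation splits into x_n y_n = 0 and c(y) |x_t| = x_t . y_t
([friction_contactP]); when x_t and y_t do not vanish, the latter forces
mum y_n <= |y_t| and the equality case of Cauchy-Schwarz ([dot_eq_enorm]), that
is, x_t is a nonnegative multiple of y_t. *)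

(** * Euclidean geometry of the tangent plane *)

Section Plane.
Set Implicit Arguments.
Unset Strict Implicit.
Context {R : realType}.
Implicit Types (u v : 'rV[R]_2) (a : R).

Lemma dotE u v : dot u v = u 0 0 * v 0 0 + u 0 1 * v 0 1.
Proof.
rewrite /dot big_ord_recl big_ord1.
by have -> : lift ord0 ord0 = 1 :> 'I_2 by exact/val_inj.
Qed.

Lemma dotC u v : dot u v = dot v u.
Proof. by rewrite !dotE; ring. Qed.

Lemma dot_ge0 u : 0 <= dot u u.
Proof. by rewrite dotE -!expr2 addr_ge0 ?sqr_ge0. Qed.

Lemma enorm_ge0 u : 0 <= enorm u.
Proof. exact: sqrtr_ge0. Qed.

Lemma enorm_sqr u : enorm u ^+ 2 = dot u u.
Proof. exact/sqr_sqrtr/dot_ge0. Qed.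

Lemma dot0l v : dot 0 v = 0.
Proof. by rewrite dotE !mxE; ring. Qed.

Lemma dot0r u : dot u 0 = 0.
Proof. by rewrite dotC dot0l. Qed.

Lemma enorm0 : enorm (0 : 'rV[R]_2) = 0.
Proof. by rewrite /enorm dot0l sqrtr0. Qed.

Lemma dot_eq0 u : dot u u = 0 -> u = 0.
Proof.
have sq i : true -> 0 <= u 0 i * u 0 i by rewrite -expr2 sqr_ge0.
move=> /(psumr_eq0P sq) u0; apply/rowP => i; rewrite mxE.
by apply/eqP; have /eqP := u0 i isT; rewrite mulf_eq0 orbb.
Qed.

Lemma enorm_eq0 u : enorm u = 0 -> u = 0.
Proof. by move=> u0; apply: dot_eq0; rewrite -enorm_sqr u0 expr0n. Qed.

Lemma enormZ a u : enorm (a *: u) = `|a| * enorm u.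
Proof.
rewrite /enorm -sqrtr_sqr -sqrtrM ?sqr_ge0//; congr Num.sqrt.
by rewrite !dotE !mxE; ring.
Qed.

(** This identity contains both the Cauchy-Schwarz inequality, since its
left-hand side is nonnegative, and the case of equality, where that side
vanishes. *)
Lemma dot_cross_diff u v :
  dot (enorm v *: u - enorm u *: v) (enorm v *: u - enorm u *: v)
  = enorm u * enorm v * (enorm u * enorm v - dot u v) *+ 2.
Proof.
have -> : dot (enorm v *: u - enorm u *: v) (enorm v *: u - enorm u *: v)
  = enorm v ^+ 2 * dot u u + enorm u ^+ 2 * dot v v
    - enorm u * enorm v * dot u v *+ 2 by rewrite !dotE !mxE; ring.
by rewrite -!enorm_sqr; ring.
Qed.

Lemma dot_le_enorm u v : dot u v <= enorm u * enorm v.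
Proof.
have [/enorm_eq0->|u0] := eqVneq (enorm u) 0; first by rewrite dot0l enorm0 mul0r.
have [/enorm_eq0->|v0] := eqVneq (enorm v) 0; first by rewrite dot0r enorm0 mulr0.
have uv0 : 0 < enorm u * enorm v by rewrite mulr_gt0// lt_neqAle eq_sym ?u0 ?v0 enorm_ge0.
have := dot_ge0 (enorm v *: u - enorm u *: v).
by rewrite dot_cross_diff pmulrn_lge0// pmulr_rge0// subr_ge0.
Qed.

Lemma dot_eq_enorm u v : v != 0 -> dot u v = enorm u * enorm v ->
  u = (enorm u / enorm v) *: v.
Proof.
move=> v0 uv; have nv0 : enorm v != 0 by apply: contra_neq v0 => /enorm_eq0.
have /dot_eq0/eqP : dot (enorm v *: u - enorm u *: v) (enorm v *: u - enorm u *: v) = 0.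
  by rewrite dot_cross_diff uv subrr mulr0 mul0rn.
rewrite subr_eq0 => /eqP vu.
by rewrite mulrC -scalerA -vu scalerA mulVf// scale1r.
Qed.

Lemma enormD u v : enorm (u + v) <= enorm u + enorm v.
Proof.
rewrite -(@ler_pXn2r _ 2)// ?nnegrE ?addr_ge0 ?enorm_ge0//.
have -> : enorm (u + v) ^+ 2 = enorm u ^+ 2 + enorm v ^+ 2 + dot u v *+ 2.
  by rewrite !enorm_sqr !dotE !mxE; ring.
have := dot_le_enorm u v; nra.
Qed.

Lemma enorm_convex u v (t : R) : 0 <= t <= 1 ->
  enorm (t *: u + (1 - t) *: v) <= t * enorm u + (1 - t) * enorm v.
Proof.
move=> /andP[t0 t1]; apply: le_trans (enormD _ _) _.
by rewrite !enormZ !ger0_norm// subr_ge0.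
Qed.

Lemma enorm_continuous : continuous (@enorm R).
Proof.
have dot_cont : continuous (fun u : 'rV[R]_2 => dot u u).
  rewrite (funext (fun u => dotE u u)) => u.
  have coord j : {for u, continuous (fun u : 'rV[R]_2 => u 0 j)}.
    exact: coord_continuous.
  exact: continuousD (continuousM (coord 0) (coord 0)) (continuousM (coord 1) (coord 1)).
by move=> u; apply: (continuous_comp (dot_cont u)); exact: sqrt_continuous.
Qed.

Lemma tangent_norm_continuous : continuous (fun y : contact_space R => enorm y.2).
Proof. by move=> y; apply: continuous_comp; [exact: cvg_snd|exact: enorm_continuous]. Qed.

End Plane.

(** * Sums of finite functions and indicators *)

Section IndicatorSums.
Set Implicit Arguments.
Unset Strict Implicit.
Context {R : realType}.
Implicit Types (f : contact_space R -> R) (A : set (contact_space R)).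

Lemma chi_in A x : A x -> chi A x = 0%E.
Proof. by move=> Ax; rewrite /chi mem_set. Qed.

Lemma chi_out A x : ~ A x -> chi A x = +oo%E.
Proof. by move=> nAx; rewrite /chi memNset. Qed.

(** An end point outside [A] makes the right-hand side of the convexity
inequality +oo, unless its weight is 0; since 0 * +oo = 0, both sides are then
the value at the other end point. *)
Lemma econvex_add_chi f A :
  (forall x z (t : R), 0 <= t <= 1 -> A x -> A z ->
    A (t *: x + (1 - t) *: z) /\
    f (t *: x + (1 - t) *: z) <= t * f x + (1 - t) * f z) ->
  econvex (fun x => (f x)%:E + chi A x)%E.
Proof.
move=> fA; pose phi x : \bar R := ((f x)%:E + chi A x)%E; change (econvex phi).
have phiNy x (t : R) : 0 <= t -> (t%:E * phi x != -oo)%E.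
  move=> t0; rewrite /phi; have [Ax|nAx] := pselect (A x).
    by rewrite chi_in// adde0 -EFinM.
  rewrite chi_out// addey//; move: t0; rewrite le_eqVlt => /predU1P[<-|t0].
    by rewrite mul0e.
  by rewrite gt0_muley.
have out (x z : contact_space R) (t : R) : 0 <= t <= 1 -> ~ A x ->
    (phi (t *: x + (1 - t) *: z)%R <= t%:E * phi x + (1 - t)%R%:E * phi z)%E.
  move=> /andP[t0 t1] nAx; move: t0; rewrite le_eqVlt => /predU1P[<-|t0].
    by rewrite scale0r mul0e !add0r subr0 scale1r mul1e.
  rewrite [in leRHS]/phi (chi_out nAx) addey// gt0_muley ?lte_fin// addye ?leey//.
  by rewrite phiNy ?subr_ge0.
move=> x z t t01; have [Ax|nAx] := pselect (A x); last exact: out.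
have [Az|nAz] := pselect (A z); last first.
  have t01' : 0 <= 1 - t <= 1 by move: t01; lra.
  by have := out z x (1 - t) t01' nAz; rewrite subKr addrC addeC.
have [At ft] := fA x z t t01 Ax Az.
by rewrite /phi !chi_in// !adde0 -!EFinM -EFinD lee_fin.
Qed.

(** Fixing one argument of a potential whose two arguments are constrained
separately leaves a domain of this form. *)
Lemma closed_guard (P : Prop) A : closed A -> closed [set x | P /\ A x].
Proof.
move=> Acl; have [p|np] := pselect P.
  by rewrite (_ : mkset _ = A)//; apply/seteqP; split=> [x []|x].
by rewrite (_ : mkset _ = set0); [exact: closed0|apply/seteqP; split=> [x []|x]].
Qed.

(** At a point of [A] the bound comes from the continuity of [f]; elsewhere the
open complement of [A] is a neighborhood on which the sum is +oo. *)
Lemma lower_semicontinuous_add_chi f A : continuous f -> closed A ->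
  lower_semicontinuous (fun x => (f x)%:E + chi A x)%E.
Proof.
move=> fc Ac x a; have [Ax|nAx] := pselect (A x) => afx; last first.
  exists (~` A); first by apply: open_nbhs_nbhs; split => //; exact: closed_openC.
  by move=> y nAy; rewrite chi_out// addey// ltry.
exists (f @^-1` [set r | a < r]).
  apply: fc; apply: open_nbhs_nbhs; split; first exact: open_gt.
  by move: afx; rewrite chi_in// adde0 lte_fin.
move=> y /= afy; have [Ay|nAy] := pselect (A y).
  by rewrite chi_in// adde0 lte_fin.
by rewrite chi_out// addey// ltry.
Qed.

End IndicatorSums.

(** * Subgradients and the contact equation *)

Section Contact.
Set Implicit Arguments.
Unset Strict Implicit.
Context {R : realType}.
Implicit Types (x y z u : contact_space R).

Lemma dualityC x y : duality x y = duality y x.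
Proof. by rewrite /duality mulrC dotC. Qed.

Lemma dualityBl x z u : duality (z - x) u = duality z u - duality x u.
Proof. by rewrite /duality !dotE /= !mxE; ring. Qed.

Lemma duality0l u : duality 0 u = 0.
Proof. by rewrite /duality dot0l mul0r addr0. Qed.

(** Testing the subgradient inequality at the origin gives the only nontrivial
direction. *)
Lemma subdifferential_contact (phi : contact_space R -> \bar R) x u :
  (forall z, ((duality z u)%:E <= phi z)%E) ->
  ((phi x < +oo)%E -> phi 0 = 0%E) ->
  subdifferential phi x u <-> phi x = (duality x u)%:E.
Proof.
move=> phi_ge phi0; split => [[phix sub]|phixu]; last first.
  split=> [|z]; first by rewrite phixu ltry.
  by rewrite phixu dualityBl EFinB leeB.
apply/eqP; rewrite eq_le phi_ge andbT.
have := sub 0; rewrite phi0// dualityBl duality0l.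
by move: phix (phi_ge x); case: (phi x) => [r _ _| |]//; rewrite -EFinB !lee_fin; lra.
Qed.

(** Coulomb's bipotential and its blurred variant share this shape, with
[thr y] the threshold of the friction stress under the contact force [y]. *)
Definition friction_potential (thr : contact_space R -> R)
    (K : set (contact_space R)) x y : \bar R :=
  ((thr y * enorm x.2)%:E + chi K y + chi K0_dual x)%E.

Variables (thr : contact_space R -> R) (K : set (contact_space R)).
Local Notation b := (friction_potential thr K).

Lemma friction_potentialE x y : K y -> K0_dual x ->
  b x y = (thr y * enorm x.2)%:E.
Proof. by move=> Ky x0; rewrite /friction_potential !chi_in// !adde0. Qed.

Lemma friction_potential_lty x y : (b x y < +oo)%E -> K y /\ K0_dual x.
Proof.
rewrite /friction_potential => bxy.
have [Ky|nKy] := pselect (K y); last first.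
  by move: bxy; rewrite (chi_out nKy) addey// /chi; case: ifP; rewrite ?adde0 ?addey.
have [x0|nx0] := pselect (K0_dual x); first by [].
by move: bxy; rewrite (chi_out nx0) (chi_in Ky) adde0 addey.
Qed.

Hypothesis K_normal : forall y, K y -> 0 <= y.1.
Hypothesis K_thr : forall y, K y -> enorm y.2 <= thr y.

(** Cauchy-Schwarz bounds the power of friction, and the sign conditions make
that of the normal contact force nonpositive. *)
Lemma friction_power_bounds x y : K y -> K0_dual x ->
  dot x.2 y.2 <= thr y * enorm x.2 /\ x.1 * y.1 <= 0.
Proof.
move=> Ky x0; split; last by rewrite mulr_le0_ge0// K_normal.
apply: le_trans (dot_le_enorm _ _) _.
by rewrite mulrC ler_wpM2r ?enorm_ge0// K_thr.
Qed.

Lemma friction_potential_ge x y : ((duality x y)%:E <= b x y)%E.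
Proof.
case: (ltP (b x y) +oo%E) => [/friction_potential_lty[Ky x0]|]; last first.
  by rewrite leye_eq => /eqP ->; rewrite leey.
rewrite friction_potentialE// lee_fin.
by have [] := friction_power_bounds Ky x0; rewrite /duality; lra.
Qed.

Lemma friction_subdifferentialX x y :
  subdifferential (b^~ y) x y <-> b x y = (duality x y)%:E.
Proof.
apply: subdifferential_contact => [z|/friction_potential_lty[Ky _]].
  exact: friction_potential_ge.
by rewrite friction_potentialE ?enorm0 ?mulr0// /K0_dual /=.
Qed.

Lemma friction_subdifferentialY x y : K 0 -> thr 0 = 0 ->
  subdifferential (b x) y x <-> b x y = (duality x y)%:E.
Proof.
move=> K0 thr0; rewrite dualityC.
apply: subdifferential_contact => [z|/friction_potential_lty[_ x0]].
  by rewrite dualityC; exact: friction_potential_ge.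
by rewrite friction_potentialE// thr0 mul0r.
Qed.

(** Contact splits into a complementarity condition in the normal direction
and an equality of powers in the tangential one, because both corresponding
inequalities hold for all admissible pairs. *)
Lemma friction_contactP x y : b x y = (duality x y)%:E <->
  [/\ K y, x.1 <= 0, x.1 * y.1 = 0 & thr y * enorm x.2 = dot x.2 y.2].
Proof.
split=> [bxy|[Ky x0 xy0 E]]; last first.
  by rewrite friction_potentialE// /duality xy0 add0r E.
have [Ky x0] : K y /\ K0_dual x by apply: friction_potential_lty; rewrite bxy ltry.
move: bxy; rewrite friction_potentialE// /duality => -[E].
by have [t n] := friction_power_bounds Ky x0; split => //; lra.
Qed.

Lemma friction_bipotential : K 0 -> thr 0 = 0 ->
  continuous thr -> closed K ->
  (forall y w (t : R), 0 <= t <= 1 -> K y -> K w ->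
    K (t *: y + (1 - t) *: w) /\
    thr (t *: y + (1 - t) *: w) <= t * thr y + (1 - t) * thr w) ->
  bipotential b.
Proof.
move=> K0 thr0 thr_cont Kcl Kcvx.
(* When y is outside K, the partial function in x is +oo everywhere: it is then
   the sum of a finite function and of the indicator of the empty set. *)
have bX y : b^~ y = (fun x => (thr y * enorm x.2)%:E
    + chi [set x : contact_space R | K y /\ K0_dual x] x)%E.
  apply/funext => x; have [Ky|nKy] := pselect (K y); last first.
    rewrite /friction_potential (chi_out nKy) [in RHS]chi_out => [|[]//].
    by rewrite addey// /chi; case: ifP; rewrite ?adde0 ?addey.
  rewrite /friction_potential (chi_in Ky) adde0; congr (_ + _)%E.
  by have [x0|x0] := pselect (K0_dual x); [rewrite !chi_in|rewrite !chi_out// => -[]].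
have bY x : b x = (fun y => (thr y * enorm x.2)%:E
    + chi [set y : contact_space R | K y /\ K0_dual x] y)%E.
  by apply/funext => y; exact: (congr1 (@^~ x) (bX y)).
split.
- move=> x y; exact: lt_le_trans (ltNyr _) (friction_potential_ge x y).
- split=> [y|x].
    rewrite bX; split; last first.
      apply: lower_semicontinuous_add_chi.
        by move=> x; apply: cvgM; [exact: cvg_cst|exact: tangent_norm_continuous].
      apply: closed_guard; apply: (preimage_closed _ (@closed_le _ 0)).
      by move=> x _; exact: cvg_fst.
    apply: econvex_add_chi => x z t t01 [Ky x0] [_ z0]; split.
      split => //; change (t * x.1 + (1 - t) * z.1 <= 0).
      move: t01 x0 z0 => /andP[t0 t1] /= x0 z0.
      by rewrite -[leRHS]addr0 lerD// mulr_ge0_le0// subr_ge0.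
    have := enorm_convex x.2 z.2 t01; have := K_thr Ky; have := enorm_ge0 y.2.
    move=> /=; nra.
  rewrite bY; split; last first.
    apply: lower_semicontinuous_add_chi.
      by move=> y; apply: cvgM; [exact: thr_cont|exact: cvg_cst].
    rewrite (_ : mkset _ = [set y | K0_dual x /\ K y]); first exact: closed_guard.
    by apply/seteqP; split=> y [].
  apply: econvex_add_chi => y w t t01 [Ky x0] [Kw _].
  have [Kt ht] := Kcvx y w t t01 Ky Kw; split => //.
  have := enorm_ge0 x.2; move=> /=; nra.
- exact: friction_potential_ge.
- move=> x y; rewrite friction_subdifferentialX friction_subdifferentialY//; tauto.
Qed.

End Contact.

(** * Coulomb's cone and the two friction laws *)

Section FrictionLaws.
Set Implicit Arguments.
Unset Strict Implicit.
Context {R : realType}.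
Implicit Types (x y w : contact_space R) (mu mum mup : R).

Lemma coulomb_cone_normal mu y : 0 < mu -> coulomb_cone mu y -> 0 <= y.1.
Proof.
by move=> mu0 Ky; rewrite -(pmulr_rge0 _ mu0); exact: le_trans (enorm_ge0 _) Ky.
Qed.

Lemma coulomb_cone0 mu : coulomb_cone mu (0 : contact_space R).
Proof. by rewrite /coulomb_cone /= enorm0 mulr0. Qed.

Lemma coulomb_cone_convex mu y w (t : R) : 0 <= t <= 1 ->
  coulomb_cone mu y -> coulomb_cone mu w -> coulomb_cone mu (t *: y + (1 - t) *: w).
Proof.
move=> t01 Ky Kw; apply: le_trans (enorm_convex y.2 w.2 t01) _.
change (t * enorm y.2 + (1 - t) * enorm w.2 <= mu * (t * y.1 + (1 - t) * w.1)).
case/andP: t01 => t0 t1.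
by rewrite mulrDr !(mulrCA mu) lerD// ler_wpM2l// subr_ge0.
Qed.

Lemma normal_continuous mu : continuous (fun y : contact_space R => mu * y.1 : R).
Proof. by move=> y; apply: cvgM; [exact: cvg_cst|exact: cvg_fst]. Qed.

Lemma coulomb_cone_closed mu : closed (@coulomb_cone R mu).
Proof.
rewrite (_ : coulomb_cone mu
    = (fun y : contact_space R => enorm y.2 - mu * y.1 : R) @^-1` [set r | r <= 0]).
  apply: (preimage_closed _ (@closed_le _ 0)) => y _.
  by apply: cvgB; [exact: tangent_norm_continuous|exact: normal_continuous].
by apply/seteqP; split=> y; rewrite /coulomb_cone /= subr_le0.
Qed.

Definition blurred_threshold mum y : R := Num.max (mum * y.1) (enorm y.2).

Lemma blurred_threshold_convex mum y w (t : R) : 0 <= t <= 1 ->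
  blurred_threshold mum (t *: y + (1 - t) *: w)
  <= t * blurred_threshold mum y + (1 - t) * blurred_threshold mum w.
Proof.
move=> t01; have /andP[t0 t1] := t01; have s0 : 0 <= 1 - t by rewrite subr_ge0.
rewrite /blurred_threshold ge_max; apply/andP; split.
  change (mum * (t * y.1 + (1 - t) * w.1)
    <= t * Num.max (mum * y.1) (enorm y.2) + (1 - t) * Num.max (mum * w.1) (enorm w.2)).
  by rewrite mulrDr !(mulrCA mum) lerD// ler_wpM2l// le_max lexx.
apply: le_trans (enorm_convex y.2 w.2 t01) _.
by rewrite lerD// ler_wpM2l// le_max lexx orbT.
Qed.

Lemma blurred_threshold_continuous mum : continuous (blurred_threshold mum).
Proof.
move=> y; exact: continuous_max (@normal_continuous mum y) (@tangent_norm_continuous R y).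
Qed.

Lemma blurred_threshold_ge mum y : enorm y.2 <= blurred_threshold mum y.
Proof. by rewrite le_max lexx orbT. Qed.

Lemma blurred_bipotentialE mum mup :
  blurred_bipotential mum mup
  = friction_potential (blurred_threshold mum) (coulomb_cone mup).
Proof. by []. Qed.

Lemma blurred_is_bipotential mum mup : 0 < mup ->
  bipotential (blurred_bipotential mum mup).
Proof.
move=> mup0; rewrite blurred_bipotentialE; apply: friction_bipotential.
- by move=> y; exact: coulomb_cone_normal.
- by move=> y _; exact: blurred_threshold_ge.
- exact: coulomb_cone0.
- by rewrite /blurred_threshold /= enorm0 mulr0 maxxx.
- exact: blurred_threshold_continuous.
- exact: coulomb_cone_closed.
- move=> y w t t01 Ky Kw; split; first exact: coulomb_cone_convex.
  exact: blurred_threshold_convex.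
Qed.

Lemma blurred_contactP mum mup x y : 0 < mup ->
  blurred_bipotential mum mup x y = (duality x y)%:E <->
  [/\ coulomb_cone mup y, x.1 <= 0, x.1 * y.1 = 0
    & blurred_threshold mum y * enorm x.2 = dot x.2 y.2].
Proof.
move=> mup0; rewrite blurred_bipotentialE; apply: friction_contactP => z.
  exact: coulomb_cone_normal.
by move=> _; exact: blurred_threshold_ge.
Qed.

Lemma blurred_subdifferentialP mum mup x y : 0 < mup ->
  subdifferential ((blurred_bipotential mum mup)^~ y) x y <->
  blurred_bipotential mum mup x y = (duality x y)%:E.
Proof.
move=> mup0; rewrite blurred_bipotentialE; apply: friction_subdifferentialX => z.
  exact: coulomb_cone_normal.
by move=> _; exact: blurred_threshold_ge.
Qed.

Lemma coulomb_subdifferentialP mu x y : 0 < mu ->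
  subdifferential ((coulomb_bipotential mu)^~ y) x y <->
  [/\ coulomb_cone mu y, x.1 <= 0, x.1 * y.1 = 0
    & mu * y.1 * enorm x.2 = dot x.2 y.2].
Proof.
move=> mu0; pose thr (y : contact_space R) : R := mu * y.1.
have normal z : coulomb_cone mu z -> 0 <= z.1 by exact: coulomb_cone_normal.
have bound z : coulomb_cone mu z -> enorm z.2 <= thr z by [].
exact: iff_trans (friction_subdifferentialX normal bound x y)
                 (friction_contactP normal bound x y).
Qed.

(** The coefficient selected by a nonzero contact force [y] of the outer cone
is the ratio of the blurred threshold to the contact pressure. *)
Lemma blurred_coefficient mum mup y : 0 < mum -> mum <= mup ->
  coulomb_cone mup y ->
  exists mu, [/\ mum <= mu <= mup, coulomb_cone mu y
               & mu * y.1 = blurred_threshold mum y].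
Proof.
move=> mum0 le_mu Ky; have mup0 := lt_le_trans mum0 le_mu.
have := coulomb_cone_normal mup0 Ky; rewrite le_eqVlt => /predU1P[y0|y0].
  have yt0 : enorm y.2 = 0.
    by apply/le_anti; rewrite enorm_ge0 andbT (le_trans Ky)// -y0 mulr0.
  (* Here y = 0, and any coefficient of the interval would do. *)
  exists mum; rewrite lexx le_mu /coulomb_cone /blurred_threshold /=.
  by rewrite -y0 yt0 mulr0 maxxx.
have ratio : blurred_threshold mum y / y.1 * y.1 = blurred_threshold mum y.
  by rewrite divfK// gt_eqF.
exists (blurred_threshold mum y / y.1); split => //.
  rewrite ler_pdivlMr// ler_pdivrMr// /blurred_threshold le_max lexx/= ge_max.
  by rewrite ler_pM2r// le_mu; exact: Ky.
by rewrite /coulomb_cone /= ratio blurred_threshold_ge.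
Qed.

(** Both sides are contact equations. For a Coulomb law with coefficient
[mu >= mum], the blurred threshold lies between |y_t| and [mu * y_n], so the
equality of powers, together with Cauchy-Schwarz, is inherited from the Coulomb
law. Conversely, [blurred_coefficient] chooses [mu] such that the two thresholds
coincide. *)
Lemma blurred_subdifferential_union mum mup x y : 0 < mum -> mum <= mup ->
  (exists mu, mum <= mu <= mup /\ subdifferential ((coulomb_bipotential mu)^~ y) x y)
  <-> subdifferential ((blurred_bipotential mum mup)^~ y) x y.
Proof.
move=> mum0 le_mu; have mup0 := lt_le_trans mum0 le_mu.
rewrite blurred_subdifferentialP// blurred_contactP//.
split=> [[mu [/andP[mu1 mu2]]]|[Ky x0 xy0 E]]; last first.
  have [mu [mu12 Kmu Emu]] := blurred_coefficient mum0 le_mu Ky.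
  exists mu; split => //; have /andP[mu1 _] := mu12.
  by apply/(coulomb_subdifferentialP x y (lt_le_trans mum0 mu1)); split; rewrite ?Emu.
have mu0 := lt_le_trans mum0 mu1.
move=> /(coulomb_subdifferentialP x y mu0)[Kmu x0 xy0 E].
have y0 := coulomb_cone_normal mu0 Kmu.
split=> //; first by apply: le_trans Kmu _; rewrite ler_wpM2r.
apply/le_anti/andP; split; last first.
  apply: le_trans (dot_le_enorm _ _) _.
  by rewrite mulrC ler_wpM2r ?enorm_ge0// blurred_threshold_ge.
rewrite -E ler_wpM2r ?enorm_ge0// ge_max; apply/andP; split; last exact: Kmu.
by rewrite ler_wpM2r.
Qed.

(** If x_t <> 0, the equality of powers gives max(mum y_n, |y_t|) <= |y_t|, hence
equality in Cauchy-Schwarz, hence the sliding states of the graph if y_t <> 0.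
Two kinds of solutions escape this argument and form the boundary states: y = 0
with x_t <> 0, and x = 0 with y in the interior of the inner cone. *)
Lemma graph_blurred_bipotential mum mup : 0 < mum -> mum <= mup ->
  blurred_graph mum mup `|` boundary_states mum
  = graph (@blurred_bipotential R mum mup).
Proof.
move=> mum0 le_mu; have mup0 := lt_le_trans mum0 le_mu.
apply/seteqP; split=> -[[xn xt] [yn yt]]; rewrite /graph /mkset /=.
  move=> st; apply/(blurred_contactP _ _ _ mup0).
  rewrite /coulomb_cone /blurred_threshold /=.
  move: st => [[[/= xn0 [-> ->]]|[/= -> /andP[le1 le2] [eta [eta0 ->]]]]
              |[[/= -> xt0 [-> ->]]|[/= [-> ->] lt1]]].
  - by rewrite enorm0 !mulr0 maxxx mul0r dot0r; split=> //; exact: ltW.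
  - rewrite mul0r lexx max_r// enormZ ger0_norm//; split => //.
    by rewrite mulrCA -expr2 enorm_sqr !dotE !mxE; ring.
  - by rewrite enorm0 !mulr0 maxxx mul0r dot0r.
  - rewrite mul0r lexx enorm0 mulr0 dot0l; split => //.
    have yn0 : 0 < yn.
      by rewrite -(pmulr_rgt0 _ mum0); exact: le_lt_trans (enorm_ge0 _) lt1.
    by apply: le_trans (ltW lt1) _; rewrite ler_pM2r.
move=> /(blurred_contactP _ _ _ mup0)[/[dup] /(coulomb_cone_normal mup0)].
rewrite /coulomb_cone /blurred_threshold /= => yn0 Ky xn0 xyn E.
have yt_vanish : yn = 0 -> yt = 0.
  move=> yn00; apply: enorm_eq0; apply/le_anti.
  by rewrite enorm_ge0 andbT (le_trans Ky)// yn00 mulr0.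
move: xn0; rewrite le_eqVlt => /predU1P[xn0|xn0]; last first.
  have {}yn0 : yn = 0.
    by apply/eqP; move/eqP: xyn; rewrite mulf_eq0 lt_eqF.
  by left; left; split => //=; rewrite yn0 yt_vanish.
have [xt0|xt0] := eqVneq xt 0.
  (* Sticking: the position of y with respect to the inner cone decides. *)
  have [le1|lt1] := leP (mum * yn) (enorm yt); last by right; right; rewrite xn0 xt0.
  left; right; split => //=; first by rewrite le1.
  by exists 0; rewrite lexx scale0r xt0.
have nxt0 : 0 < enorm xt.
  by rewrite lt_neqAle enorm_ge0 andbT eq_sym; apply: contra_neq xt0 => /enorm_eq0.
have [yt0|yt0] := eqVneq yt 0.
  right; left; split => //=; congr (_, _) => //.
  move: E; rewrite yt0 dot0r enorm0 => /eqP; rewrite mulf_eq0 (gt_eqF nxt0) orbF.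
  by move=> /eqP/max_idPr; rewrite pmulr_rle0// => yn1; apply/le_anti; rewrite yn1.
have le1 : Num.max (mum * yn) (enorm yt) <= enorm yt.
  by rewrite -(ler_pM2r nxt0) E mulrC dot_le_enorm.
left; right; split => //=.
  by rewrite (le_trans _ le1) ?le_max ?lexx.
exists (enorm xt / enorm yt); rewrite divr_ge0 ?enorm_ge0//; split => //.
apply: dot_eq_enorm => //; rewrite -E mulrC; congr (_ * _).
by apply/le_anti; rewrite le1 le_max lexx orbT.
Qed.

End FrictionLaws.

Theorem proposition6p1 (R : realType) (mum mup : R)
    (hmum : 0 < mum) (hmu : mum <= mup) :
  [/\ bipotential (blurred_bipotential mum mup),
      blurred_graph mum mup `|` boundary_states mum
        = graph (blurred_bipotential mum mup)
    & forall x y : contact_space R,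
        (exists mu : R, mum <= mu <= mup /\
           subdifferential ((coulomb_bipotential mu)^~ y) x y) <->
        subdifferential ((blurred_bipotential mum mup)^~ y) x y].
Proof.
split.
- exact/blurred_is_bipotential/(lt_le_trans hmum hmu).
- exact: graph_blurred_bipotential.
- by move=> x y; exact: blurred_subdifferential_union.
Qed.
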